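(* Let $k,l\ge 1$, let $X\subseteq\mathcal C^k$ be null-additive, and let $Y\subseteq\mathcal C^l$ be strongly meager. Then $X\times Y\subseteq\mathcal C^{k+l}$ is strongly meager.
   Context: $\mathcal C=\{0,1\}^{\mathbb N}$ is the Cantor space with the product topology and the measure $\mu$ that is the product of the uniform probability measures on $\{0,1\}$; $\mathcal C^k$ carries the product measure $\mu\times\dots\times\mu$ ($k$ times), and ''null'' refers to this measure. $\mathcal C^k\times\mathcal C^l$ is identified with $\mathcal C^{k+l}$. $\oplus$ denotes coordinatewise addition modulo 2 on $\mathcal C$, and the induced group operation on $\mathcal C^k$; for $A,B\subseteq\mathcal C^k$, $A\oplus B=\{a\oplus b: a\in A,\ b\in B\}$. A set $X\subseteq\mathcal C^k$ is null-additive if for each null $N\subseteq\mathcal C^k$, $X\oplus N$ is null in $\mathcal C^k$. A set $X\subseteq\mathcal C^k$ is strongly meager if for each null $N\subseteq\mathcal C^k$, $X\oplus N\neq\mathcal C^k$. *)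

(* Defs.v *)
From HB Require Import structures.
From mathcomp Require Import all_boot all_order all_algebra.
From mathcomp Require Import all_classical all_reals all_analysis.
From mathcomp Require Import measurable_realfun ring lra.

Set Implicit Arguments.
Unset Strict Implicit.
Unset Printing Implicit Defensive.

Import Order.TTheory GRing.Theory Num.Theory.
Import numFieldNormedType.Exports.

Local Open Scope classical_set_scope.
Local Open Scope ring_scope.

(* The product sigma-algebra on {0,1}^nat is generated by the sets that
   constrain a single coordinate. *)
Definition cantor_coord_sets : set (set cantor_space) :=
  [set U | exists (i : nat) (A : set bool), U = [set x : cantor_space | A (x i)]].

HB.instance Definition _ := @isMeasurable.Build
  (sigma_display cantor_coord_sets) cantor_space <<s cantor_coord_sets >>
  (@sigma_algebra0 _ setT cantor_coord_sets)
  (@sigma_algebraC _ cantor_coord_sets)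
  (@sigma_algebra_bigcup _ setT cantor_coord_sets).

Definition cantor_box (n : nat) (A : nat -> set bool) : set cantor_space :=
  [set x : cantor_space | forall i, (i < n)%N -> A i (x i)].

(* P is the product of countably many copies of the uniform probability on
   {0,1}: a box has the product of the measures of its sides. *)
Definition is_coin_measure (R : realType) (P : probability cantor_space R) :=
  forall (n : nat) (A : nat -> set bool),
    P (cantor_box n A) = (\prod_(i < n) bernoulli_prob (2^-1 : R) (A i))%E.

Lemma measurable_coord (i : nat) (A : set bool) :
  measurable [set x : cantor_space | A (x i)].
Proof. by apply: sub_sigma_algebra; exists i, A. Qed.

Lemma cantor_box_bigcap n A :
  cantor_box n A = \big[setI/setT]_(i < n) [set x : cantor_space | A i (x i)].
Proof.
rewrite -(bigcap_mkord n (fun i => [set x : cantor_space | A i (x i)])).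
by apply/seteqP; split.
Qed.

Lemma measurable_cantor_box n A : measurable (cantor_box n A).
Proof.
rewrite cantor_box_bigcap; apply: bigsetI_measurable => i _.
exact: measurable_coord.
Qed.

Lemma coin_measure_unique (R : realType) (P Q : probability cantor_space R) :
  is_coin_measure P -> is_coin_measure Q ->
  forall A, measurable A -> P A = Q A.
Proof.
move=> hP hQ A mA.
pose G : set (set cantor_space) := [set U | exists n B, U = cantor_box n B].
apply: (@measure_unique _ R cantor_space G (fun=> setT)) => //.
- apply/seteqP; split.
  + apply: smallest_sub; first exact: smallest_sigma_algebra.
    move=> _ [i [B ->]]; apply: sub_sigma_algebra.
    exists i.+1, (fun j => if j == i then B else setT).
    apply/seteqP; split => x /=; last by move/(_ i); rewrite eqxx; exact.
    by move=> Bx j _; case: eqP => // ->.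
  + apply: smallest_sub; first exact: sigma_algebra_measurable.
    by move=> _ [n [B ->]]; exact: measurable_cantor_box.
- move=> _ _ [n [B ->]] [m [C ->]].
  exists (maxn n m), (fun i => (if (i < n)%N then B i else setT) `&`
                               (if (i < m)%N then C i else setT)).
  apply/seteqP; split => x /=.
    by move=> [h1 h2] i _; split; case: ifP => //; [exact: h1|exact: h2].
  move=> h; split => i ilt.
    by have /= := h i; rewrite leq_max ilt => /(_ isT) [].
  by have /= := h i; rewrite leq_max ilt orbT => /(_ isT) [].
- by move=> _; exists 0%N, (fun=> setT); apply/seteqP; split.
- by rewrite bigcup_const.
- by move=> _ [n [B ->]]; exact: (etrans (hP n B) (esym (hQ n B))).
- by move=> _; apply: (le_lt_trans (probability_le1 P measurableT)); rewrite ltry.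
Qed.

(* Existence: the law of the binary digits of a uniform point of [0, 1[. *)
Section coin_measure_exists.
Variable R : realType.

Fixpoint frac_shift (n : nat) (t : R) : R :=
  if n is m.+1 then
    if 2^-1 <= frac_shift m t then 2 * frac_shift m t - 1
    else 2 * frac_shift m t
  else t.

Definition digit (t : measurableTypeR R) : cantor_space := fun n => 2^-1 <= frac_shift n t.

Lemma measurable_frac_shift n : measurable_fun [set: R] (frac_shift n).
Proof.
elim: n => [|n IH] /=; first exact: measurable_id.
have m2 : measurable_fun [set: R] (fun t => 2 * frac_shift n t).
  by apply: (measurable_funM (measurable_cst _) IH).
apply: measurable_fun_ifT => //; first exact: measurable_fun_ler.
exact: measurable_funB.
Qed.

Lemma measurable_digit : measurable_fun [set: measurableTypeR R] digit.
Proof.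
apply: (measurability cantor_coord_sets) => //.
move=> _ [_ [i [A ->]] <-]; rewrite setTI.
rewrite [X in measurable X](_ : _ =
  setT `&` (fun t => 2^-1 <= frac_shift i t) @^-1` A); last by rewrite setTI.
apply: (measurable_fun_ler (measurable_cst _) (measurable_frac_shift i)) => //.
Qed.

HB.instance Definition _ :=
  isMeasurableFun.Build _ _ (measurableTypeR R) cantor_space digit
    measurable_digit.

Definition unit_interval_measure : set (measurableTypeR R) -> \bar R :=
  mrestr (@lebesgue_measure R) (measurable_itv `[0, 1[).

HB.instance Definition _ := Measure.on unit_interval_measure.

Lemma unit_interval_measureT : unit_interval_measure [set: R] = 1%E.
Proof.
rewrite /unit_interval_measure /mrestr setTI lebesgue_measure_itv/=.
by rewrite lte_fin ltr01 oppr0 adde0.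
Qed.

HB.instance Definition _ := Measure_isProbability.Build _ _ _
  unit_interval_measure unit_interval_measureT.

Definition digit_law : probability cantor_space R :=
  distribution unit_interval_measure digit.

Definition left_end (s : nat -> bool) (n : nat) : R :=
  \sum_(i < n) (s i)%:R * 2^-1 ^+ i.+1.

Lemma digit_cell (s : nat -> bool) n t : 0 <= t < 1 ->
  ((forall i, (i < n)%N -> digit t i = s i) <->
    left_end s n <= t < left_end s n + 2^-1 ^+ n) /\
  ((forall i, (i < n)%N -> digit t i = s i) ->
    t = left_end s n + 2^-1 ^+ n * frac_shift n t).
Proof.
move=> t01; elim: n => [|n [IHc IHr]].
  by rewrite /left_end big_ord0 expr0 !add0r mul1r; split.
have ES : left_end s n.+1 = left_end s n + (s n)%:R * 2^-1 ^+ n.+1.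
  by rewrite /left_end big_ord_recr.
have E2 : 2^-1 ^+ n.+1 = 2^-1 * 2^-1 ^+ n :> R by rewrite exprS.
have p0 : 0 < 2^-1 ^+ n :> R by rewrite exprn_gt0// invr_gt0.
have split_lt : (forall i, (i < n.+1)%N -> digit t i = s i) <->
    (forall i, (i < n)%N -> digit t i = s i) /\ digit t n = s n.
  split=> [h|[h1 h2] i]; first by split=> [i /ltnW|]; exact: h.
  by rewrite ltnS leq_eqVlt => /predU1P[->//|]; exact: h1.
split; last first.
  move=> /split_lt[/IHr {}IHr dn].
  rewrite ES E2 {1}IHr /= -/(digit t n) -dn /digit.
  by case: ifP => _ /=; field.
rewrite split_lt ES E2 /digit; split.
  move=> [h]; move: (h) => /IHc c; move: h => /IHr r.
  move: c r; set f := frac_shift n t; set a := left_end s n => c r.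
  set p := 2^-1 ^+ n in p0 c r *.
  have f1 : f < 1 by nra.
  have f0 : 0 <= f by nra.
  by move=> <-; case: (leP 2^-1 f) => hf /=; apply/andP; split; nra.
move=> h.
have h' : left_end s n <= t < left_end s n + 2^-1 ^+ n.
  by move: h; set p := 2^-1 ^+ n in p0 *; case: (s n) => /= h; lra.
split; first exact/IHc.
have r := IHr (IHc.2 h').
move: r h; set f := frac_shift n t; set a := left_end s n.
set p := 2^-1 ^+ n in p0 *.
by case: (s n) => /= r h; case: (leP 2^-1 f) => hf //; exfalso; nra.
Qed.

Lemma left_end_bound s n : 0 <= left_end s n /\ left_end s n + 2^-1 ^+ n <= 1.
Proof.
elim: n => [|n [IH0 IH1]].
  by rewrite /left_end big_ord0 expr0 add0r.
rewrite /left_end big_ord_recr/= -/(left_end s n) exprS.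
have p0 : 0 < 2^-1 ^+ n :> R by rewrite exprn_gt0// invr_gt0.
by set p := 2^-1 ^+ n in p0 IH1 *; case: (s n) => /=; split; lra.
Qed.

Lemma digit_law_cylinder (s : nat -> bool) n :
  digit_law (cantor_box n (fun i => [set s i])) = (2^-1 ^+ n)%:E.
Proof.
rewrite /digit_law/= /distribution /pushforward/= /unit_interval_measure /mrestr.
have [l0 l1] := left_end_bound s n.
have p0 : 0 < 2^-1 ^+ n :> R by rewrite exprn_gt0// invr_gt0.
rewrite [X in lebesgue_measure X](_ : _ =
  `[left_end s n, left_end s n + 2^-1 ^+ n[%classic).
  rewrite lebesgue_measure_itv/= lte_fin ltrDl p0 -EFinB.
  by congr EFin; lra.
apply/seteqP; split => t /=; rewrite !in_itv/=.
  by move=> [h t01]; apply/((digit_cell s n t01).1).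
move=> h; have t01 : 0 <= t < 1 by lra.
by split => //; apply/((digit_cell s n t01).1).
Qed.

Lemma bernoulli_half (A : set bool) : bernoulli_prob (2^-1 : R) A =
  ((2^-1 : R) * ((true \in A)%:R + (false \in A)%:R))%:E.
Proof.
have h0 : 0 <= 2^-1 :> R by rewrite invr_ge0.
have h1 : (NngNum h0)%:num <= 1 :> R by rewrite /=; lra.
rewrite (bernoulli_dirac h1) measure_addE/= /mscale/= !diracE.
by rewrite -!EFinM -EFinD; congr EFin; lra.
Qed.

Lemma digit_law_mixed n m (s : nat -> bool) (A : nat -> set bool) :
  digit_law (cantor_box (m + n)
    (fun i => if (i < m)%N then [set s i] else A i)) =
  ((2^-1 ^+ m)%:E * \prod_(i < n) bernoulli_prob (2^-1 : R) (A (m + i)%N))%E.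
Proof.
elim: n m s => [|n IH] m s.
  rewrite big_ord0 mule1 addn0 -(digit_law_cylinder s m); congr (digit_law _).
  by apply/seteqP; split => x /= h i im; have := h i im; rewrite im.
set U := cantor_box _ _.
pose s' b i := if i == m then b else s i.
pose V b := cantor_box (m.+1 + n)
  (fun i => if (i < m.+1)%N then [set s' b i] else A i).
have VU b : U `&` [set x : cantor_space | [set b] (x m)] =
    if b \in A m then V b else set0.
  apply/seteqP; split => x /=.
    move=> [Ux xm]; case: ifPn => [_ i|].
      rewrite addSnnS => ilt; have := Ux i ilt; rewrite /s' ltnS.
      by case: ltngtP => //= ->.
    rewrite notin_setE; apply.
    by have := Ux m; rewrite -addSnnS leq_addr ltnn xm; exact.
  case: ifPn => // /set_mem bA Vx; split.
    move=> i; rewrite -addSnnS => ilt; have := Vx i ilt; rewrite /s' ltnS.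
    by case: ltngtP => //= -> ->.
  by have /= := Vx m; rewrite leq_addr leqnn /s' eqxx; exact.
have -> : U = (U `&` [set x : cantor_space | [set true] (x m)]) `|`
              (U `&` [set x : cantor_space | [set false] (x m)]).
  rewrite -setIUr -[LHS]setIT; congr (_ `&` _); apply/seteqP; split => x //= _.
  by case: (x m); [left|right].
have mU : measurable U by exact: measurable_cantor_box.
have mUb b : measurable (U `&` [set x : cantor_space | [set b] (x m)]).
  by apply: measurableI => //; exact: (measurable_coord m [set b]).
rewrite (_ : digit_law (_ `|` _) =
    (digit_law (U `&` [set x : cantor_space | [set true] (x m)]) +
     digit_law (U `&` [set x : cantor_space | [set false] (x m)]))%E); last first.
  apply: (measureU _ (mUb true) (mUb false)).
  by apply/seteqP; split => x //= [[_ ->] [_]].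
rewrite !VU big_ord_recl addn0 bernoulli_half.
under eq_bigr => i _ do rewrite [(m + _)%N](_ : _ = (m.+1 + i)%N) ?lift0 ?addnS ?addSn//.
have Vb b : digit_law (if b \in A m then V b else set0) =
   ((b \in A m)%:R%:E * ((2^-1 ^+ m.+1)%:E *
      \prod_(i < n) bernoulli_prob (2^-1 : R) (A (m.+1 + i)%N)))%E.
  case: ifP => _; last by rewrite mul0e; exact: measure0.
  by rewrite mul1e IH.
rewrite !Vb.
have [q ->] : exists q : R,
    (\prod_(i < n) bernoulli_prob (2^-1 : R) (A (m.+1 + i)%N) = q%:E)%E.
  exists (\prod_(i < n)
    ((2^-1 : R) * ((true \in A (m.+1 + i)%N)%:R + (false \in A (m.+1 + i)%N)%:R))).
  by rewrite -prodEFin; apply: eq_bigr => i _; rewrite bernoulli_half.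
rewrite -!EFinM -EFinD exprS; congr EFin; ring.
Qed.

End coin_measure_exists.

Lemma coin_measure_exists (R : realType) :
  exists P : probability cantor_space R, is_coin_measure P.
Proof.
exists (digit_law R) => n A.
by have := digit_law_mixed R n 0 (fun=> true) A; rewrite expr0 mul1e.
Qed.

Definition coin_measure (R : realType) : probability cantor_space R :=
  sval (cid (coin_measure_exists R)).

Lemma coin_measureP (R : realType) : is_coin_measure (coin_measure R).
Proof. exact: svalP (cid (coin_measure_exists R)). Qed.

Definition cantor_pow (k : nat) : Type := k.-tuple cantor_space.
HB.instance Definition _ k := Measurable.on (cantor_pow k).

Definition cantor_cons (k : nat) (p : cantor_space * cantor_pow k) :
  cantor_pow k.+1 := [tuple of p.1 :: p.2].

Lemma measurable_cantor_cons k : measurable_fun [set: _] (@cantor_cons k).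
Proof. exact: (measurable_cons measurable_fst measurable_snd). Qed.

HB.instance Definition _ k :=
  isMeasurableFun.Build _ _ _ _ (@cantor_cons k) (@measurable_cantor_cons k).

(* The k-fold product mu x ... x mu, transported along the bijection
   C * C^k -> C^(k+1); for k = 0 it is the unit mass on the empty tuple. *)
Fixpoint coin_pow (R : realType) (k : nat) : probability (cantor_pow k) R :=
  if k is k'.+1 then
    distribution (coin_measure R \x coin_pow R k')%E (@cantor_cons k')
  else \d_([tuple] : cantor_pow 0).

Definition null (R : realType) (k : nat) (N : set (cantor_pow k)) : Prop :=
  (coin_pow R k).-negligible N.

Definition cantor_xor (x y : cantor_space) : cantor_space :=
  fun n => x n (+) y n.

Definition cantor_pow_xor (k : nat) (x y : cantor_pow k) : cantor_pow k :=
  [tuple cantor_xor (tnth x i) (tnth y i) | i < k].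

Definition set_xor (k : nat) (A B : set (cantor_pow k)) : set (cantor_pow k) :=
  [set cantor_pow_xor a b | a in A & b in B].

Definition null_additive (R : realType) (k : nat) (X : set (cantor_pow k)) :=
  forall N, null R N -> null R (set_xor X N).

Definition strongly_meager (R : realType) (k : nat) (X : set (cantor_pow k)) :=
  forall N, null R N -> set_xor X N <> [set: cantor_pow k].

(* X x Y under the identification of C^k x C^l with C^(k+l). *)
Definition cantor_prod (k l : nat) (X : set (cantor_pow k))
    (Y : set (cantor_pow l)) : set (cantor_pow (k + l)) :=
  [set [tuple of x ++ y] | x in X & y in Y].

(* Main.v *)
Require Import Defs.
From HB Require Import structures.
From mathcomp Require Import all_boot all_order all_algebra.
From mathcomp Require Import all_classical all_reals all_analysis.
From mathcomp Require Import ring lra zify.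

(** Fix a null set [N] in [C^(k+l)].  The plan is to show that the union [Q]
    of the sets [(x, 0) + N] for [x] in [X] is still null.  By Fubini some [a]
    in [C^k] then has a null section [Q_a] in [C^l] ([null_cat_section]); as [Y]
    is strongly meager, some [b] lies outside [Y + Q_a], and this says exactly
    that [(a, b)] lies outside [(X x Y) + N].

    That [Q] is null ([null_additive_cat0]) rests on the hard half of Shelah's
    combinatorial description of null-additive sets
    ([null_additive_slalom]).  There is a function [H], fixed in advance, such
    that for any lengths [d n] the set [X] is a countable union of pieces, each
    of which shows at most [H n] different prefixes of length [d n] for all
    large [n].  Since [H] does not depend on [d], one may first cover [N] by the
    upper limit of clopen sets [F n] of measure at most [2^-n / (H n + 1)], and
    then let [d n] be the number of bits deciding [F n].  The points of one
    piece translate [F n] in at most [H n] ways, so that the translates together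
    have measure at most [2^-n], and Borel-Cantelli concludes.

    To capture [X] in this way, let [G n] be the set of the [z] whose prefix
    of length [d n], read as a number, points to a block of [n] later bits all
    equal to zero ([sparse]).  It has measure [2^-n], hence the upper limit [M] of the
    [G n] is null, and so is [X + M].  On the other hand, translates of [G n] by
    points with different prefixes look at different blocks, and are therefore
    independent once the prefix of [z] is fixed: [h] of them leave out a set of
    measure exactly [(1 - 2^-n)^h] ([pr_avoid_sparse]).  Now a closed set [K] of
    positive measure avoids [X + M]; it may be chosen such that every nonempty
    relatively open part of it has positive measure ([kernel_off]).  For [x] in
    [X], the Baire argument [baire_lim_sup] turns the disjointness of [K] and
    [x + M] into a cylinder that meets [K] and whose trace on [K] avoids
    [x + G n] for all large [n].  There are countably many such cylinders and
    thresholds, and for each of them the trace has some measure [delta > 0].  If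
    the corresponding [x] had more than [H n] prefixes of length [d n], then
    [delta] would be at most [(1 - 2^-n)^(H n) <= 2^-n], which fails for large
    [n]. *)

Set Implicit Arguments.
Unset Strict Implicit.
Unset Printing Implicit Defensive.

Import Order.TTheory GRing.Theory Num.Theory.
Import numFieldNormedType.Exports.

Local Open Scope classical_set_scope.
Local Open Scope ring_scope.

(** * Real-valued probabilities *)
Section probability_real.
Context d (T : measurableType d) (R : realType) (P : probability T R).
Implicit Types A B : set T.

Definition pr A : R := fine (P A).

Lemma prE A : measurable A -> P A = (pr A)%:E.
Proof. by move=> mA; rewrite /pr fineK// fin_num_measure. Qed.

Lemma pr_ge0 A : 0 <= pr A.
Proof. exact: fine_ge0. Qed.

Lemma prT : pr setT = 1.
Proof. by rewrite /pr probability_setT. Qed.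

Lemma pr_le A B : measurable A -> measurable B -> A `<=` B -> pr A <= pr B.
Proof.
move=> mA mB AB; rewrite -lee_fin -!prE//.
by apply: le_measure => //; rewrite inE.
Qed.

Lemma prID A B : measurable A -> measurable B ->
  pr A = pr (A `&` B) + pr (A `\` B).
Proof.
move=> mA mB; apply: EFin_inj; rewrite EFinD -!prE//.
- by rewrite addeC; exact: measureDI.
- exact: measurableD.
- exact: measurableI.
Qed.

Lemma pr_bigcup_seq (I : choiceType) (s : seq I) (F : I -> set T) (c : R) :
  (forall i, measurable (F i)) -> (forall i, i \in s -> pr (F i) <= c) ->
  pr (\bigcup_(i in [set` s]) F i) <= (size s)%:R * c.
Proof.
move=> mF; rewrite bigcup_seq; elim: s => [|i s IH] Fc.
  by rewrite big_nil mul0r /pr measure0.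
rewrite big_cons -natr1 mulrDl mul1r addrC.
have mU : measurable (\big[setU/set0]_(j <- s) F j) by exact: bigsetU_measurable.
apply: (@le_trans _ _ (pr (F i) + pr (\big[setU/set0]_(j <- s) F j))).
  rewrite -lee_fin EFinD -!prE//; last exact: measurableU.
  exact: measureU2.
apply: lerD; first by rewrite Fc ?mem_head.
by apply: IH => j js; rewrite Fc// in_cons js orbT.
Qed.

Lemma pr_negligible A : measurable A -> P.-negligible A -> pr A = 0.
Proof. by move=> mA /(measure_negligible mA); rewrite /pr => ->. Qed.

Lemma pr0_negligible A : measurable A -> pr A = 0 -> P.-negligible A.
Proof. by move=> mA A0; exists A; split=> //; rewrite prE// A0. Qed.

End probability_real.

(** * Sets of points determined by finitely many bits *)
Section bits.
Context (m : nat).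
Implicit Types (x y z : cantor_pow m) (p : nat) (F U : set (cantor_pow m)).

(** Only the first [p] bits of each of the [m] coordinates are compared, so
    that the classes of [agree p] are the basic clopen sets. *)
Definition agree p x y :=
  forall i j, (j < p)%N -> tnth x i j = tnth y i j.

Definition bit_prefix p x : {ffun 'I_m * 'I_p -> bool} :=
  [ffun ij : 'I_m * 'I_p => tnth x ij.1 ij.2].

Lemma bit_prefixP p x y : bit_prefix p x = bit_prefix p y <-> agree p x y.
Proof.
split=> [/ffunP h i j jp|h].
  by have := h (i, Ordinal jp); rewrite !ffunE.
by apply/ffunP => -[i j]; rewrite !ffunE; exact: h.
Qed.

Lemma agree_sym p x y : agree p x y -> agree p y x.
Proof. by move=> h i j jp; rewrite h. Qed.

Lemma agree_trans p y x z : agree p x y -> agree p y z -> agree p x z.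
Proof. by move=> h1 h2 i j jp; rewrite h1// h2. Qed.

Lemma agree_le p q x y : (p <= q)%N -> agree q x y -> agree p x y.
Proof. by move=> pq h i j jp; apply: h; exact: leq_trans pq. Qed.

Definition decided p F := forall x y, agree p x y -> F x -> F y.

(** These are the open sets of the product topology. *)
Definition bit_open U :=
  forall x, U x -> exists p, forall y, agree p x y -> U y.

(** The union of the basic clopen sets of level [p] inside [U]: an increasing
    clopen approximation of an open [U] from inside. *)
Definition bit_core p U := [set x | forall y, agree p x y -> U y].

Lemma decidedS p q F : (p <= q)%N -> decided p F -> decided q F.
Proof. by move=> pq dF x y /(agree_le pq); exact: dF. Qed.

Lemma decided_core p U : decided p (bit_core p U).
Proof. by move=> x y xy Ux z yz; apply: Ux; exact: agree_trans yz. Qed.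

Lemma bit_core_sub p U : bit_core p U `<=` U.
Proof. by move=> x; apply. Qed.

Lemma bit_core_le p q U : (p <= q)%N -> bit_core p U `<=` bit_core q U.
Proof. by move=> pq x Ux y /(agree_le pq); exact: Ux. Qed.

Lemma bit_openE U : bit_open U -> \bigcup_p bit_core p U = U.
Proof.
move=> oU; apply/seteqP; split=> [x [p _]|x /oU[p Up]]; first exact: bit_core_sub.
by exists p.
Qed.

Lemma decided_open p F : decided p F -> bit_open F.
Proof. by move=> dF x Fx; exists p => y xy; exact: dF Fx. Qed.

Lemma measurable_bit (i : 'I_m) j (b : bool) :
  measurable [set x : cantor_pow m | tnth x i j = b].
Proof.
have mA := measurable_coord j [set b].
by have := measurable_tnth i measurableT mA; rewrite setTI.
Qed.

Lemma measurable_bit_prefix p w : measurable [set x : cantor_pow m | bit_prefix p x = w].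
Proof.
rewrite (_ : [set _ | _] = \bigcap_(ij in [set: 'I_m * 'I_p])
    [set x : cantor_pow m | tnth x ij.1 ij.2 = w ij]).
  apply: fin_bigcap_measurable => [|ij _]; first exact: finite_finset.
  exact: measurable_bit.
apply/seteqP; split=> [x /= <- ij _|x h]; first by rewrite /= ffunE.
by apply/ffunP => ij; rewrite ffunE; exact: h.
Qed.

Lemma measurable_decided p F : decided p F -> measurable F.
Proof.
move=> dF; rewrite (_ : F = \bigcup_(w in bit_prefix p @` F)
    [set x : cantor_pow m | bit_prefix p x = w]).
  apply: fin_bigcup_measurable => [|w _]; first exact: finite_finset.
  exact: measurable_bit_prefix.
apply/seteqP; split=> [x Fx|x [_ [y Fy <-]] /=]; first by exists (bit_prefix p x).
by move/bit_prefixP/agree_sym/dF; exact.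
Qed.

Lemma measurable_bit_open U : bit_open U -> measurable U.
Proof.
move=> /bit_openE <-; apply: bigcupT_measurable => p.
exact: measurable_decided (@decided_core p U).
Qed.

Lemma bit_open_bigcup (F : nat -> set (cantor_pow m)) :
  (forall n, bit_open (F n)) -> bit_open (\bigcup_n F n).
Proof.
move=> oF x [n _ /oF[p Fp]]; exists p => y xy; exists n => //; exact: Fp.
Qed.

Lemma bit_openI U V : bit_open U -> bit_open V -> bit_open (U `&` V).
Proof.
move=> oU oV x [/oU[p Up] /oV[q Vq]]; exists (maxn p q) => y xy; split.
  by apply: Up; apply: agree_le xy; exact: leq_maxl.
by apply: Vq; apply: agree_le xy; exact: leq_maxr.
Qed.

End bits.

(** * Translation invariance *)
Section translation.
Context (R : realType).

Lemma measurable_cantor_xor (a : cantor_space) :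
  measurable_fun [set: cantor_space] (cantor_xor a).
Proof.
apply: (measurability cantor_coord_sets) => //.
move=> _ [_ [i [A ->]] <-]; rewrite setTI.
exact: (measurable_coord i [set b | A (a i (+) b)]).
Qed.

HB.instance Definition _ (a : cantor_space) :=
  isMeasurableFun.Build _ _ cantor_space cantor_space (cantor_xor a)
    (measurable_cantor_xor a).

Lemma coin_measure_xor (a : cantor_space) (A : set cantor_space) :
  measurable A -> coin_measure R (cantor_xor a @^-1` A) = coin_measure R A.
Proof.
move=> mA; pose Q := distribution (coin_measure R) (cantor_xor a).
apply: (@coin_measure_unique R Q) => // [n B|]; last exact: coin_measureP.
rewrite [LHS](coin_measureP R n (fun i => [set b | B i (a i (+) b)])).
apply: eq_bigr => i _; rewrite !bernoulli_half; congr (_ * _)%:E.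
have E b : (b \in [set b | B i (a i (+) b)]) = (a i (+) b \in B i).
  by apply/idP/idP; rewrite !inE.
by rewrite !E; case: (a i) => //=; rewrite addrC.
Qed.

Lemma measurable_cantor_pow_xor m (x : cantor_pow m) :
  measurable_fun [set: cantor_pow m] (cantor_pow_xor x).
Proof.
apply/measurable_fun_tnthP => i.
rewrite (_ : _ \o _ = cantor_xor (tnth x i) \o (@tnth _ _ ^~ i)).
  by apply: measurableT_comp => //; exact: measurable_tnth.
by apply/funext => y /=; rewrite tnth_mktuple.
Qed.

Lemma cantor_pow_xor_cons m (c d : cantor_space) (x y : cantor_pow m) :
  cantor_pow_xor (cantor_cons (c, x)) (cantor_cons (d, y)) =
  cantor_cons (cantor_xor c d, cantor_pow_xor x y).
Proof.
apply/eq_from_tnth => i; rewrite tnth_mktuple.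
by case: (unliftP ord0 i) => [j ->|->]; rewrite ?tnth0 ?tnthS ?tnth_mktuple.
Qed.

(** As every element is its own inverse, the preimage under the translation by
    [x] is also the translate [x + A]; preimages commute with all set operations
    by computation. *)
Definition translate m (x : cantor_pow m) (A : set (cantor_pow m)) :=
  cantor_pow_xor x @^-1` A.

Lemma measurable_translate m (x : cantor_pow m) A :
  measurable A -> measurable (translate x A).
Proof.
by move=> mA; rewrite -[translate x A]setTI; exact: measurable_cantor_pow_xor.
Qed.

(** Both sides are measures of [A] that factor over rectangles, the factors being
    translation invariant by [coin_measure_xor] and by induction. *)
Lemma coin_pow_translate m (x : cantor_pow m) A :
  measurable A -> coin_pow R m (translate x A) = coin_pow R m A.
Proof.
elim: m x A => [|m IH] x A mA.
  congr (coin_pow R 0 _); apply/seteqP; split=> y;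
    by rewrite /translate /= (tuple0 (cantor_pow_xor x y)) (tuple0 y).
pose c := thead x; pose x' : cantor_pow m := [tuple of behead x].
have xE : x = cantor_cons (c, x') by apply: val_inj; rewrite /= {1}[x]tuple_eta.
pose f (z : cantor_space * cantor_pow m) := (cantor_xor c z.1, cantor_pow_xor x' z.2).
have mf : measurable_fun [set: _] f.
  apply: measurable_fun_pair => /=.
    by apply: measurableT_comp => //; exact: measurable_fst.
  apply: measurableT_comp; first exact: measurable_cantor_pow_xor.
  exact: measurable_snd.
pose B := @cantor_cons m @^-1` A.
have mB : measurable B.
  by rewrite -[B]setTI; exact: measurable_cantor_cons.
change ((coin_measure R \x coin_pow R m)%E (@cantor_cons m @^-1` translate x A) =
        (coin_measure R \x coin_pow R m)%E B).
rewrite (_ : _ @^-1` _ = f @^-1` B); last first.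
  by apply/seteqP; split=> -[d y]; rewrite /translate /B /= xE cantor_pow_xor_cons.
pose F : {mfun (cantor_space * cantor_pow m)%type >->
               (cantor_space * cantor_pow m)%type} := mfun_Sub (mem_set mf).
apply/esym.
apply: (@product_measure_unique _ _ _ _ R (coin_measure R) (coin_pow R m)
  (pushforward (coin_measure R \x coin_pow R m)%E F)) => // C D mC mD.
transitivity ((coin_measure R \x coin_pow R m)%E
  ((cantor_xor c @^-1` C) `*` (translate x' D))); first by [].
rewrite product_measure1E.
- congr (_ * _)%E; [exact: coin_measure_xor|exact: IH].
- by rewrite -[X in measurable X]setTI; exact: measurable_cantor_xor.
- exact: measurable_translate.
Qed.

Lemma pr_translate m (x : cantor_pow m) A :
  measurable A ->
  pr (coin_pow R m) (translate x A) = pr (coin_pow R m) A.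
Proof. by move=> mA; rewrite /pr coin_pow_translate. Qed.

Lemma tnth_xor m (x z : cantor_pow m) i n :
  tnth (cantor_pow_xor x z) i n = tnth x i n (+) tnth z i n.
Proof. by rewrite tnth_mktuple. Qed.

Lemma cantor_pow_xorK m (x : cantor_pow m) : involutive (cantor_pow_xor x).
Proof.
move=> z; apply/eq_from_tnth => i; rewrite !tnth_mktuple.
by apply/funext => n; rewrite /cantor_xor addKb.
Qed.

Lemma bit_open_translate m (x : cantor_pow m) U :
  bit_open U -> bit_open (translate x U).
Proof.
move=> oU z /oU[p Up]; exists p => y zy; apply: Up => i n np.
by rewrite !tnth_xor zy.
Qed.

End translation.

(** * Limits of probabilities *)
Section probability_limits.
Context d (T : measurableType d) (R : realType) (P : probability T R).

Lemma pr_bigcup_le (F : nat -> set T) (e : R) : 0 <= e ->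
  (forall n, measurable (F n)) -> (forall n, pr P (F n) <= e / 2 ^+ n.+1) ->
  pr P (\bigcup_n F n) <= e.
Proof.
move=> e0 mF Fe; rewrite -lee_fin -prE; last exact: bigcupT_measurable.
have mU : measurable (\bigcup_n F n) by exact: bigcupT_measurable.
apply: (le_trans (measure_sigma_subadditive P mF mU (@subset_refl _ _))).
apply: le_trans (epsilon_trick0 xpredT e0).
apply: lee_nneseries => // n _.
by have := Fe n; rewrite -lee_fin -prE// natrX.
Qed.

Lemma pr_exhaust (F : nat -> set T) (e : R) : 0 < e ->
  (forall n, measurable (F n)) -> (forall n m, (n <= m)%N -> F n `<=` F m) ->
  exists k, forall j, (k <= j)%N -> pr P ((\bigcup_n F n) `\` F j) <= e.
Proof.
move=> e0 mF ndF.
pose G j := (\bigcup_n F n) `\` F j.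
have mU : measurable (\bigcup_n F n) by exact: bigcupT_measurable.
have mG j : measurable (G j) by exact: measurableD.
have capG : \bigcap_j G j = set0.
  apply/seteqP; split=> // z h; have [[n _ Fn] _] := h 0%N I.
  by have [_] := h n I; exact.
have cG : P (G j) @[j --> \oo] --> P (\bigcap_j G j).
  apply: nonincreasing_cvg_mu => //.
  - by rewrite ltey_eq fin_num_measure.
  - by rewrite capG.
  - by move=> i j ij; apply/subsetPset => z [Uz nF]; split=> // /(ndF _ _ ij).
rewrite capG measure0 in cG.
have {}cG : pr P (G j) @[j --> \oo] --> (0 : R).
  by apply: fine_cvg.
have /cvgrPdist_le/(_ _ e0)[k _ kP] := cG.
exists k => j kj; have := kP j kj.
by rewrite sub0r normrN ger0_norm// pr_ge0.
Qed.

(** The bound is only asked from [n0] on because the upper limit ignores any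
    initial segment. *)
Lemma borel_cantelli (F : nat -> set T) (n0 : nat) :
  (forall n, measurable (F n)) ->
  (forall n, (n0 <= n)%N -> pr P (F n) <= 2^-1 ^+ n) ->
  P.-negligible (lim_sup_set F).
Proof.
move=> mF Fe; pose G n := F (n + n0)%N.
have sub : lim_sup_set F `<=` lim_sup_set G.
  move=> z h n _; have [j /= nj Fj] := h (n + n0)%N I.
  exists (j - n0)%N => /=; first lia.
  by rewrite /G subnK//; lia.
apply: (negligibleS sub); exists (lim_sup_set G); split=> //.
  apply: bigcapT_measurable => n; apply: bigcup_measurable => j _; exact: mF.
apply: lim_sup_set_cvg0 => [n|]; first exact: mF.
have h2 : 0 <= 2 :> R by [].
apply: (le_lt_trans _ (ltry 2)).
apply: le_trans (epsilon_trick0 xpredT h2).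
apply: lee_nneseries => // n _.
have := Fe _ (leq_addl n n0); rewrite -lee_fin -prE// => /le_trans; apply.
rewrite lee_fin natrX exprS invfM mulVKf// exprVn lef_pV2 ?posrE ?exprn_gt0//.
by rewrite ler_eXn2l ?ltr1n// leq_addr.
Qed.

End probability_limits.

(** * Outer regularity *)
Section regularity.
Context (R : realType) (m : nat).
Let P := coin_pow R m.

(** Approximation of [A] and of its complement at the same time makes the class
    visibly stable under complement, which outer approximation alone is not. *)
Definition bit_regular (A : set (cantor_pow m)) :=
  measurable A /\ forall e : R, 0 < e -> exists U V,
    [/\ bit_open U, bit_open V, A `<=` U, ~` A `<=` V & pr P (U `&` V) <= e].

Lemma bit_regular_decided p A : decided p A -> bit_regular A.
Proof.
move=> dA; split=> [|e e0]; first exact: measurable_decided dA.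
exists A, (~` A); split=> //; first exact: decided_open dA.
  apply: (@decided_open _ p) => x y /agree_sym xy nAx /(dA _ _ xy); exact: nAx.
by rewrite setICr /pr measure0 ltW.
Qed.

Lemma bit_regularC A : bit_regular A -> bit_regular (~` A).
Proof.
move=> [mA rA]; split=> [|e /rA[U [V [oU oV AU AV UV]]]]; first exact: measurableC.
by exists V, U; split=> //; [rewrite setCK|rewrite setIC].
Qed.

(** Opens around the complement of a countable union cannot be intersected
    infinitely often; intersecting [k] of them costs the part of the union of the
    [U n] not yet exhausted at stage [k]. *)
Lemma bit_regular_bigcup (A : nat -> set (cantor_pow m)) :
  (forall n, bit_regular (A n)) -> bit_regular (\bigcup_n A n).
Proof.
move=> rA; split=> [|e e0]; first by apply: bigcupT_measurable => n; have [] := rA n.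
have e20 : 0 < e / 2 by rewrite divr_gt0.
have /choice[UV hUV] n : exists UV : set (cantor_pow m) * set (cantor_pow m),
    [/\ bit_open UV.1, bit_open UV.2, A n `<=` UV.1, ~` A n `<=` UV.2 &
        pr P (UV.1 `&` UV.2) <= e / 2 / 2 ^+ n.+1].
  have [_ /(_ (e / 2 / 2 ^+ n.+1))[|U [V h]]] := rA n; last by exists (U, V).
  by rewrite divr_gt0// exprn_gt0.
pose U n := (UV n).1; pose V n := (UV n).2.
have oU n : bit_open (U n) by have [] := hUV n.
have oV n : bit_open (V n) by have [] := hUV n.
pose W k := \bigcup_(n < k) U n.
have oW k : bit_open (W k).
  by move=> z [n nk /oU[p Up]]; exists p => y /Up; exists n.
have WU : \bigcup_k W k = \bigcup_n U n.
  apply/seteqP; split=> z [n _]; first by case=> i _; exists i.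
  by move=> Un; exists n.+1 => //; exists n => /=.
have [k /(_ k (leqnn k))] := @pr_exhaust _ _ _ P W (e / 2) e20
  (fun k => measurable_bit_open (oW k))
  (fun i j ij z => fun '(ex_intro2 n ni Un) =>
     ex_intro2 _ _ n (leq_trans ni ij) Un).
rewrite WU => Wk.
pose Vk := \bigcap_(n < k) V n.
have oVk : bit_open Vk.
  rewrite /Vk; elim: (k) => [|i IH]; first by move=> z _; exists 0%N.
  by rewrite bigcap_mkord big_ord_recr /= -bigcap_mkord; exact: bit_openI.
exists (\bigcup_n U n), Vk; split=> //.
- exact: bit_open_bigcup.
- by apply: subset_bigcup => n _; have [] := hUV n.
- move=> z nA n _; have [_ _ _ h _] := hUV n; apply: h => An; apply: nA.
  by exists n.
have mU : measurable (\bigcup_n U n).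
  by apply: measurable_bit_open; exact: bit_open_bigcup.
have mUV n : measurable (U n `&` V n).
  by apply: measurable_bit_open; exact: bit_openI.
have mR : measurable (\bigcup_n (U n `&` V n)) by exact: bigcupT_measurable.
have mL : measurable ((\bigcup_n U n) `&` Vk).
  by apply: measurable_bit_open; apply: bit_openI => //; exact: bit_open_bigcup.
have mD : measurable ((\bigcup_n U n) `\` W k).
  by apply: measurableD => //; exact: measurable_bit_open.
rewrite (prID P mL (measurable_bit_open (oW k))) [e]splitr addrC lerD//.
  apply: le_trans Wk; apply: pr_le => //.
    by apply: measurableD => //; exact: measurable_bit_open.
  by move=> z [[Uz _] nW].
apply: (@le_trans _ _ (pr P (\bigcup_n (U n `&` V n)))).
  apply: pr_le => //.
    by apply: measurableI => //; exact: measurable_bit_open.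
  by move=> z [[_ Vz] [n nk Un]]; exists n => //; split=> //; exact: Vz.
by apply: pr_bigcup_le => //[|n]; [exact: ltW|have [] := hUV n].
Qed.

Lemma bit_regular_measurable A : measurable A -> bit_regular A.
Proof.
have sig (T : Type) (f : cantor_pow m -> T) :
    sigma_algebra setT [set B | bit_regular (f @^-1` B)].
  split=> [|B rB|B rB] /=.
  - by apply: (@bit_regular_decided 0).
  - by rewrite setTD preimage_setC; exact: bit_regularC.
  - by rewrite preimage_bigcup; exact: bit_regular_bigcup.
move: A; apply: smallest_sub; first exact: (sig _ id).
rewrite -bigcup_seq => A [i _] /= [B mB <-]; rewrite setTI.
move: B mB; apply: smallest_sub; first exact: (sig _ (@tnth _ _ ^~ i)).
move=> _ [j [B ->]] /=; apply: (@bit_regular_decided j.+1) => x y xy /=.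
by rewrite xy.
Qed.

Lemma null_open_cover N (e : R) : null R N -> 0 < e ->
  exists U, [/\ bit_open U, N `<=` U & pr P U <= e].
Proof.
move=> [A [mA A0 NA]] e0.
have [_ /(_ _ e0)[U [V [oU oV AU AV UV]]]] := bit_regular_measurable mA.
have mU := measurable_bit_open oU; have mV := measurable_bit_open oV.
exists U; split=> //; first exact: subset_trans AU.
rewrite (prID P mU mV) -[e]addr0; apply: lerD => //.
rewrite (_ : 0 = pr P A); last by rewrite /pr A0.
apply: pr_le => //; first exact: measurableD.
by move=> z [_ nV]; apply: contrapT => /AV.
Qed.

End regularity.

(** * Clopen covers of null sets *)
Section clopen_covers.
Context (R : realType) (m : nat).
Let P := coin_pow R m.
Implicit Types (F N : set (cantor_pow m)).

Lemma decidedD p A B : @decided m p A -> decided p B -> decided p (A `\` B).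
Proof.
move=> dA dB x y xy [Ax nBx]; split; first exact: dA Ax.
by move=> By; apply: nBx; exact: dB (agree_sym xy) By.
Qed.

(** An open [U] around [N] of measure at most [e 0] is cut along its clopen
    approximations [bit_core (q n) U].  Taking [q n] so large that less than
    [e n.+1] of [U] remains bounds the next layer, so the bounds may decrease
    arbitrarily fast. *)
Lemma null_decided_cover N (e : nat -> R) : null R N -> (forall n, 0 < e n) ->
  exists F : nat -> set (cantor_pow m), [/\ forall n, exists p, decided p (F n),
    forall n, pr P (F n) <= e n & N `<=` \bigcup_n F n].
Proof.
move=> nN e0; have [U [oU NU Ue]] := null_open_cover nN (e0 0%N).
have mU := measurable_bit_open oU.
have mC q : measurable (bit_core q U).
  exact: measurable_decided (@decided_core _ q U).
have /choice[q qP] n : exists q,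
    (n <= q)%N /\ pr P (U `\` bit_core q U) <= e n.+1.
  have [k kP] := @pr_exhaust _ _ _ P (fun q => bit_core q U) _ (e0 n.+1) mC
    (fun i j => @bit_core_le m i j U).
  exists (maxn n k); split; first exact: leq_maxl.
  by rewrite -{1}(bit_openE oU); apply: kP; exact: leq_maxr.
exists (fun n => if n is n'.+1 then bit_core (q n'.+1) U `\` bit_core (q n') U
                 else bit_core (q 0%N) U); split.
- move=> [|n]; first by exists (q 0%N); exact: decided_core.
  exists (maxn (q n.+1) (q n)); apply: decidedD.
    by apply: decidedS (@decided_core _ _ U); exact: leq_maxl.
  by apply: decidedS (@decided_core _ _ U); exact: leq_maxr.
- move=> [|n]; first by apply: le_trans Ue; apply: pr_le => //; exact: bit_core_sub.
  have [_] := qP n; apply: le_trans; apply: pr_le; try exact: measurableD.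
  by move=> z [/bit_core_sub Uz ?].
move=> z /NU; rewrite -{1}(bit_openE oU) => -[p _ Up].
have ex : exists n, `[< bit_core (q n) U z >].
  exists p; apply/asboolP; apply: bit_core_le Up; by have [] := qP p.
case: (ex_minnP ex) => -[|n] /asboolP Uz min; first by exists 0%N.
exists n.+1 => //; split=> // Uz'.
by have := min n (asboolT Uz'); rewrite ltnn.
Qed.

(** For every [i], a cover [F i] with the bounds shifted by [i] is placed at the
    indices [i, i+1, ...]; each point of [N] is then met at some index beyond [i].
    The set of index [n] collects [n+1] clopen sets, which explains the division
    of the bounds. *)
Lemma null_decided_lim_sup N (e : nat -> R) : null R N -> (forall n, 0 < e n) ->
  exists (F : nat -> set (cantor_pow m)) (p : nat -> nat),
    [/\ forall n, decided (p n) (F n), forall n, pr P (F n) <= e n &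
        N `<=` lim_sup_set F].
Proof.
move=> nN e0.
have /choice[F hF] i := @null_decided_cover N
  (fun n => e (i + n)%N / (i + n).+1%:R) nN (fun n => divr_gt0 (e0 _) (ltr0Sn _ _)).
pose G n := \bigcup_(i in [set` iota 0 n.+1]) F i (n - i)%N.
have dF i n : exists p, decided p (F i n) by have [] := hF i.
have /choice[p dG] n : exists p, decided p (G n).
  have /choice[p dp] i := dF i (n - i)%N.
  exists (\max_(i <- iota 0 n.+1) p i)%N => x y xy [i /= ni Fx]; exists i => //.
  apply: dp Fx; apply: agree_le xy.
  by rewrite (big_rem i)//= leq_maxl.
exists G, p; split=> // [n|z Nz].
  rewrite (_ : e n = (size (iota 0 n.+1))%:R * (e n / n.+1%:R)); last first.
    by rewrite size_iota mulrC divfK// pnatr_eq0.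
  apply: pr_bigcup_seq => i.
    by have [q] := dF i (n - i)%N; exact: measurable_decided.
  rewrite mem_iota => /= ni; have [_ /(_ (n - i)%N) + _] := hF i.
  by rewrite subnKC//; lia.
move=> i _; have [_ _ /(_ _ Nz)[n _ Fz]] := hF i.
exists (i + n)%N; first by rewrite /= leq_addr.
exists i; first by rewrite /mkset mem_iota; lia.
by rewrite addKn.
Qed.

End clopen_covers.

(** * Sections of null sets *)
Section null_sections.
Context (R : realType).

Definition cantor_cat k l (a : cantor_pow k) (b : cantor_pow l) :
  cantor_pow (k + l) := [tuple of a ++ b].

Lemma null_cons_section k (N : set (cantor_pow k.+1)) : null R N ->
  exists c, null R [set x : cantor_pow k | N (cantor_cons (c, x))].
Proof.
move=> [A [mA A0 NA]].
pose B := @cantor_cons k @^-1` A.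
have mB : measurable B.
  by rewrite -[B]setTI; exact: measurable_cantor_cons.
have B0 : (coin_measure R \x coin_pow R k)%E B = 0%E by [].
have mf := measurable_fun_xsection (coin_pow R k) mB.
have /(ae_eq_integral_abs (coin_measure R) measurableT mf)[Z [mZ Z0 sZ]] :
    (\int[coin_measure R]_c `|(coin_pow R k \o xsection B) c| = 0)%E.
  rewrite -[RHS]B0; apply: eq_integral => c _.
  by rewrite gee0_abs.
have [c nZc] : exists c, ~ Z c.
  apply/existsNP => Zall; have ZT : Z = setT by apply/seteqP; split.
  have := probability_setT (coin_measure R); rewrite -ZT => /eqP.
  by rewrite [X in X == _]Z0 eq_sym onee_eq0.
exists c, (xsection B c); split; first exact: measurable_xsection.
  by apply: contrapT => h; apply: nZc; apply: sZ => /(_ I).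
by move=> x /NA Ax; rewrite /xsection/= inE.
Qed.

(** Only one good [a] is asked for, rather than almost all: this way the induction
    peels off one coordinate at a time and meets no measurability question about
    the set of good points. *)
Lemma null_cat_section k l (N : set (cantor_pow (k + l))) : null R N ->
  exists a, null R [set b : cantor_pow l | N (cantor_cat a b)].
Proof.
elim: k N => [|k IH] N nN.
  exists [tuple]; apply: negligibleS nN => b /=.
  by rewrite (_ : cantor_cat _ _ = b)//; exact: val_inj.
have [c /IH[a h]] := @null_cons_section (k + l) N nN.
exists (cantor_cons (c, a)); apply: negligibleS h => b /=.
have -> // : cantor_cat (cantor_cons (c, a)) b =
  cantor_cons (c, cantor_cat a b) :> cantor_pow (k + l).+1.
exact: val_inj.
Qed.

End null_sections.

(** * Independence of blocks of bits *)
Section flips.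
Context (R : realType) (m : nat) (i0 : 'I_m).
Let P := coin_pow R m.
Implicit Types (E A : set (cantor_pow m)) (x z : cantor_pow m).

(** The point whose only nonzero bit is the bit [j] of coordinate [i0]:
    translating by it flips that bit. *)
Definition flip (j : nat) : cantor_pow m :=
  [tuple (fun n => (i == i0) && (n == j)) : cantor_space | i < m].

Lemma tnth_flip j z i n :
  tnth (cantor_pow_xor (flip j) z) i n = ((i == i0) && (n == j)) (+) tnth z i n.
Proof. by rewrite tnth_xor tnth_mktuple. Qed.

Definition flip_invariant (j : nat) E := translate (flip j) E = E.

Lemma flip_invariantI j A B :
  flip_invariant j A -> flip_invariant j B -> flip_invariant j (A `&` B).
Proof. by move=> iA iB; rewrite /flip_invariant -[in RHS]iA -[in RHS]iB. Qed.

Lemma flip_invariantD j A B :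
  flip_invariant j A -> flip_invariant j B -> flip_invariant j (A `\` B).
Proof. by move=> iA iB; rewrite /flip_invariant -[in RHS]iA -[in RHS]iB. Qed.

(** The flip exchanges the two halves of [E] given by the bit [j] and preserves
    the measure.  Independence of bits is derived from invariance alone. *)
Lemma pr_half j (b : bool) E : measurable E -> flip_invariant j E ->
  pr P (E `&` [set z : cantor_pow m | tnth z i0 j = b]) = pr P E / 2.
Proof.
move=> mE invE; set B := [set z | _].
have mB : measurable B by exact: measurable_bit.
have mEB : measurable (E `&` B) by exact: measurableI.
have ED : E `\` B = translate (flip j) (E `&` B).
  rewrite /translate preimage_setI -/(translate _ E) invE setDE.
  congr (_ `&` _); apply/seteqP; split=> z; rewrite /B /= tnth_flip !eqxx /=.
    by case: (tnth z i0 j); case: (b).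
  by case: (tnth z i0 j); case: (b).
rewrite (prID P mE mB) ED pr_translate//; lra.
Qed.

Definition block o b (t : nat -> bool) : set (cantor_pow m) :=
  [set z | forall r, (r < b)%N -> tnth z i0 (o + r) = t r].

Lemma decided_block o b t : decided (o + b) (block o b t).
Proof.
by move=> x y xy h r rb; rewrite -xy ?h// ltn_add2l.
Qed.

Lemma flip_invariant_block j o b t : ~~ ((o <= j) && (j < o + b))%N ->
  flip_invariant j (block o b t).
Proof.
move=> nj; have E z r : (r < b)%N ->
    tnth (cantor_pow_xor (flip j) z) i0 (o + r) = tnth z i0 (o + r).
  move=> rb; rewrite tnth_flip eqxx /=.
  by case: eqP => // orj; move: nj; rewrite -orj leq_addr ltn_add2l rb.
by apply/seteqP; split=> z h r rb; have := h r rb; rewrite E.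
Qed.

Lemma pr_block o b t E : measurable E ->
  (forall j, (o <= j < o + b)%N -> flip_invariant j E) ->
  pr P (E `&` block o b t) = pr P E / 2 ^+ b.
Proof.
move=> mE; elim: b => [|b IH] invE.
  by rewrite expr0 divr1; congr (pr P _); apply/seteqP; split=> z; [case|].
have -> : E `&` block o b.+1 t =
    (E `&` block o b t) `&`
      [set z : cantor_pow m | tnth z i0 (o + b)%N = t b].
  apply/seteqP; split=> z.
    by move=> [Ez h]; do 2?split=> //; [move=> r rb; apply: h; lia|exact: h].
  move=> [[Ez h] hb]; split=> // r; rewrite ltnS leq_eqVlt => /predU1P[->//|].
  exact: h.
rewrite pr_half.
- rewrite IH ?exprSr ?invfM ?mulrA// => j ?; apply: invE; lia.
- apply: measurableI => //; exact: measurable_decided (@decided_block o b t).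
- apply: flip_invariantI; first by apply: invE; lia.
  by apply: flip_invariant_block; rewrite ltnn andbF.
Qed.

(** Distinct values of [c] give disjoint blocks beyond [d], so the events are
    independent of each other and of [E]. *)
Lemma pr_avoid_blocks (T : eqType) (s : seq T) (c : T -> nat)
    (t : T -> nat -> bool) (d b : nat) E :
  {in s &, injective c} -> uniq s -> measurable E ->
  (forall j, (d <= j)%N -> flip_invariant j E) ->
  pr P (E `&` [set z : cantor_pow m |
      forall w, w \in s -> ~ block (d + b * c w) b (t w) z]) =
    (1 - 2^-1 ^+ b) ^+ size s * pr P E.
Proof.
move=> + + mE invE.
pose A (s : seq T) := E `&` [set z : cantor_pow m |
  forall w, w \in s -> ~ block (d + b * c w) b (t w) z].
have AS w s' : A (w :: s') = A s' `\` block (d + b * c w) b (t w).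
  apply/seteqP; split=> z.
    move=> [Ez h]; split; last by apply: h; exact: mem_head.
    by split=> // v vs; apply: h; rewrite in_cons vs orbT.
  by move=> [[Ez h] hw]; split=> // v; rewrite in_cons => /predU1P[->//|/h].
have mB w : measurable (block (d + b * c w) b (t w)).
  exact: measurable_decided (@decided_block _ b _).
have A0 : A [::] = E by apply/seteqP; split=> z; [case|].
have mA s' : measurable (A s').
  by elim: s' => [|w s' IH]; [rewrite A0|rewrite AS; exact: measurableD].
rewrite -/(A s); elim: s => [|w s IH] injc.
  by rewrite A0 expr0 mul1r.
rewrite cons_uniq => /andP[ws us].
have {}IH : pr P (A s) = (1 - 2^-1 ^+ b) ^+ size s * pr P E.
  by apply: IH us; apply: sub_in2 injc => v vs; rewrite in_cons vs orbT.
have invA (j : nat) : (d + b * c w <= j < d + b * c w + b)%N -> flip_invariant j (A s).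
  move=> jw.
  have cws v : v \in s -> c v != c w.
    move=> vs; apply/eqP => /injc; rewrite !in_cons eqxx vs orbT => /(_ isT isT) vw.
    by rewrite -vw vs in ws.
  elim: (s) cws => [|v s' IHs] cws; first by rewrite A0; apply: invE; lia.
  rewrite AS; apply: flip_invariantD.
    by apply: IHs => u us'; apply: cws; rewrite in_cons us' orbT.
  apply: flip_invariant_block; have := cws v (mem_head _ _).
  by move: jw; nia.
have := prID P (mA s) (mB w).
rewrite -AS pr_block// IH => h.
rewrite /= exprS -mulrA; set L := _ ^+ _ * pr P E in h *.
by apply: (addrI (L / 2 ^+ b)); rewrite -h exprVn; ring.
Qed.

(** The prefix of [z] of length [d], numbered by [enum_rank], selects one of the
    consecutive blocks of [b] bits that start at bit [d] of coordinate [i0]. *)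
Section sparse.
Variables (d b : nat).

Definition sparse : set (cantor_pow m) :=
  [set z : cantor_pow m | block (d + b * enum_rank (bit_prefix d z)) b (fun=> false) z].

Let W := {ffun 'I_m * 'I_d -> bool}.

Lemma decided_sparse : decided (d + b * #|{: W}|) sparse.
Proof.
move=> x y xy; have -> : sparse x =
    block (d + b * enum_rank (bit_prefix d y)) b (fun=> false) x.
  rewrite /sparse /mkset (_ : bit_prefix d x = bit_prefix d y)//.
  by apply/bit_prefixP; apply: agree_le xy; exact: leq_addr.
apply: decided_block; apply: agree_le xy.
by rewrite -addnA leq_add2l -mulnSr leq_mul2l ltn_ord orbT.
Qed.

Lemma measurable_sparse : measurable sparse.
Proof. exact: measurable_decided decided_sparse. Qed.

Lemma pr_prefix_sum A : measurable A ->
  pr P A = \sum_(w : W) pr P (A `&` [set z | bit_prefix d z = w]).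
Proof.
move=> mA.
have mw (w : W) : measurable [set z : cantor_pow m | bit_prefix d z = w].
  exact: measurable_bit_prefix.
have ms (s : seq W) : measurable (A `&` [set z | bit_prefix d z \in s]).
  apply: measurableI => //; apply: (@measurable_decided _ d) => x y /bit_prefixP /= e.
  by rewrite e.
suff H (s : seq W) : uniq s -> pr P (A `&` [set z | bit_prefix d z \in s]) =
    \sum_(w <- s) pr P (A `&` [set z | bit_prefix d z = w]).
  rewrite -[RHS]big_enum /= -H ?enum_uniq//; congr (pr P _).
  by apply/seteqP; split=> z; [move=> Az; split=> //=; rewrite mem_enum|case].
elim: s => [_|w s IH].
  rewrite big_nil /pr (_ : _ `&` _ = set0) ?measure0//.
  by apply/seteqP; split=> // z [].
rewrite cons_uniq => /andP[ws us].
rewrite big_cons -(IH us) (prID P (ms (w :: s)) (mw w)).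
congr (pr P _ + pr P _); apply/seteqP; split=> z.
- by move=> [[]].
- by move=> [Az /= zw]; split=> //; split=> //=; rewrite zw mem_head.
- by move=> [[Az /=]]; rewrite in_cons => /predU1P[].
- move=> [Az /= zs]; split; first by split=> //=; rewrite in_cons zs orbT.
  by move=> /= zw; rewrite -zw zs in ws.
Qed.

(** On the [z] with prefix [u], the translate by [rep w] asks for a fixed content
    of the block selected by [w + u]; these blocks are distinct for distinct [w],
    whatever [u] is. *)
Lemma pr_avoid_sparse (s : seq W) (rep : W -> cantor_pow m) : uniq s ->
  (forall w, w \in s -> bit_prefix d (rep w) = w) ->
  pr P [set z : cantor_pow m | forall w, w \in s -> ~ translate (rep w) sparse z] =
    (1 - 2^-1 ^+ b) ^+ size s.
Proof.
move=> us rs; set A := [set z | _].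
have mA : measurable A.
  rewrite (_ : A = \bigcap_(w in [set` s]) ~` translate (rep w) sparse).
    apply: fin_bigcap_measurable => [|w _]; first exact: finite_seq.
    by apply: measurableC; apply: measurable_translate; exact: measurable_sparse.
  by apply/seteqP; split=> z h w /h.
rewrite (pr_prefix_sum mA).
have mw (w : W) : measurable [set z : cantor_pow m | bit_prefix d z = w].
  exact: measurable_bit_prefix.
transitivity (\sum_(u : W) (1 - 2^-1 ^+ b) ^+ size s *
    pr P (setT `&` [set z : cantor_pow m | bit_prefix d z = u])); last first.
  by rewrite -mulr_sumr -pr_prefix_sum ?prT ?mulr1.
apply: eq_bigr => u _; rewrite setTI.
pose Wx (w : W) : W := [ffun ij => w ij (+) u ij].
have prefix_xor x z : bit_prefix d z = u ->
    bit_prefix d (cantor_pow_xor x z) = Wx (bit_prefix d x).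
  by move=> zu; apply/ffunP => ij; rewrite !ffunE tnth_xor -zu ffunE.
pose c (w : W) : nat := enum_rank (Wx w).
pose t w r := tnth (rep w) i0 (d + b * c w + r)%N.
rewrite -(@pr_avoid_blocks _ s c t d b) //.
- rewrite setIC; congr (pr P _); apply/seteqP; split=> z [/= zu h]; split=> // w ws.
    move=> hb; apply: (h w ws) => r rb.
    by rewrite prefix_xor// rs// tnth_xor hb ?addbb.
  move=> hb; apply: (h w ws) => r rb.
  have := hb r rb; rewrite prefix_xor// rs// tnth_xor -/(c w) /t.
  by case: (tnth (rep w) i0 _); case: (tnth z i0 _).
- move=> v w _ _ /val_inj /enum_rank_inj /ffunP e; apply/ffunP => ij.
  by have := e ij; rewrite !ffunE => /addIb.
- move=> j dj; have E z : bit_prefix d (cantor_pow_xor (flip j) z) = bit_prefix d z.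
    apply/bit_prefixP => i n nd.
    by rewrite tnth_flip (_ : (n == j) = false) ?andbF//; lia.
  by apply/seteqP; split=> z; rewrite /translate /= E.
Qed.

Lemma pr_sparse : pr P sparse = 2^-1 ^+ b.
Proof.
pose x : cantor_pow m := [tuple (fun=> false) : cantor_space | i < m].
have mS := measurable_translate x measurable_sparse.
have := @pr_avoid_sparse [:: bit_prefix d x] (fun=> x) isT.
rewrite expr1 (_ : [set _ | _] = ~` translate x sparse); last first.
  apply/seteqP; split=> z h; first by apply: h (mem_head _ _).
  by move=> w _.
have := prID P measurableT mS; rewrite prT setTI setTD pr_translate; last first.
  exact: measurable_sparse.
move=> e /(_ _)/wrap[w|h]; first by rewrite inE => /eqP.
by move: e; rewrite h; lra.
Qed.

End sparse.
End flips.

(** * A closed set all of whose nonempty parts have positive measure *)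
Section density_kernel.
Context (R : realType) (m : nat).
Let P := coin_pow R m.
Implicit Types (A B U : set (cantor_pow m)) (x y z : cantor_pow m).

Lemma pr_le_mod_null A B Z : measurable A -> measurable B ->
  P.-negligible Z -> A `<=` B `|` Z -> pr P A <= pr P B.
Proof.
move=> mA mB nZ AB; rewrite (prID P mA mB).
have -> : pr P (A `\` B) = 0.
  apply: pr_negligible; first exact: measurableD.
  by apply: negligibleS nZ => z [/AB []].
by rewrite addr0; apply: pr_le => //; exact: measurableI.
Qed.

Definition cylinder p z : set (cantor_pow m) := [set y | agree p z y].

Lemma measurable_cylinder p z : measurable (cylinder p z).
Proof.
by apply: (@measurable_decided _ p) => x y xy zx; exact: agree_trans zx xy.
Qed.

Lemma cylinder_eq p y z : agree p y z -> cylinder p y = cylinder p z.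
Proof.
move=> yz; apply/seteqP; split=> x; apply: agree_trans => //; exact: agree_sym.
Qed.

(** The support of the measure restricted to the complement of [U]. *)
Definition kernel_off U : set (cantor_pow m) :=
  [set z | forall p, 0 < pr P (cylinder p z `\` U)].

Lemma kernel_off_disjoint U z : bit_open U -> kernel_off U z -> ~ U z.
Proof.
move=> oU Kz /oU[p Up]; have := Kz p.
rewrite (_ : _ `\` U = set0) ?/pr ?measure0 ?ltxx//.
by apply/seteqP; split=> // y [/Up].
Qed.

Lemma kernel_off_closed U z :
  (forall p, exists2 y, kernel_off U y & agree p z y) -> kernel_off U z.
Proof. by move=> h p; have [y Ky /cylinder_eq ->] := h p; exact: Ky. Qed.

Lemma measurable_kernel_off U : measurable (kernel_off U).
Proof.
rewrite -[kernel_off U]setCK; apply: measurableC; apply: measurable_bit_open.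
move=> z /existsNP[p Np]; exists p => y zy Ky; apply: Np.
by rewrite (cylinder_eq zy); exact: Ky.
Qed.

(** The difference is a union of null sets, one for each of the countably many
    cylinders that are null off [U]. *)
Lemma kernel_off_full U : measurable U -> P.-negligible (~` U `\` kernel_off U).
Proof.
move=> mU.
pose W p := {ffun 'I_m * 'I_p -> bool}.
pose C p (w : W p) := [set z : cantor_pow m | bit_prefix p z = w] `\` U.
pose D p w := if pr P (@C p w) == 0 then @C p w else set0.
have mC p w : measurable (@C p w).
  by apply: measurableD => //; exact: measurable_bit_prefix.
have mD p w : measurable (@D p w) by rewrite /D; case: ifP.
pose E p := \bigcup_(w in [set` enum {: W p}]) @D p w.
have mE p : measurable (E p).
  by apply: fin_bigcup_measurable => //; exact: finite_seq.
apply: (@negligibleS _ _ _ _ (\bigcup_p E p)); last first.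
  apply: negligible_bigcup => p; apply: pr0_negligible => //.
  apply/eqP; rewrite eq_le pr_ge0 andbT -[leRHS](mulr0 (size (enum {: W p}))%:R).
  apply: pr_bigcup_seq => // w _; rewrite /D; case: ifP => [/eqP ->//|_].
  by rewrite /pr measure0.
move=> z [nU /existsNP[p /negP]]; rewrite lt_neqAle pr_ge0 andbT negbK => /eqP z0.
have cE : cylinder p z `\` U = @C p (bit_prefix p z).
  by congr (_ `\` _); apply/seteqP; split=> y /= => [/bit_prefixP//|/esym/bit_prefixP].
exists p => //; exists (bit_prefix p z); first by rewrite /= mem_enum.
by rewrite /D -cE -z0 eqxx.
Qed.

Lemma kernel_off_cylinder_gt0 U p z : measurable U -> kernel_off U z ->
  0 < pr P (kernel_off U `&` cylinder p z).
Proof.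
move=> mU Kz; apply: (lt_le_trans (Kz p)).
have mK := measurable_kernel_off U; have mc := measurable_cylinder p z.
apply: (pr_le_mod_null _ _ (kernel_off_full mU)).
- exact: measurableD.
- exact: measurableI.
- move=> y [zy nUy]; have [Ky|nKy] := pselect (kernel_off U y); first by left.
  by right.
Qed.

Lemma kernel_off_nonempty U : measurable U -> pr P U < 1 ->
  exists z, kernel_off U z.
Proof.
move=> mU U1; apply: contrapT => /forallNP K0.
have := prID P measurableT mU; rewrite prT setTI setTD => e.
suff : pr P (~` U) = 0 by move=> h; move: U1; rewrite e h addr0 ltxx.
apply: pr_negligible; first exact: measurableC.
by apply: negligibleS (kernel_off_full mU) => z nU; split=> //; exact: K0.
Qed.

(** The Baire category theorem in [K], for the upper limit of open sets [G n] of
    which every tail has a dense union in [K]. *)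
Lemma baire_lim_sup (K : set (cantor_pow m)) (G : nat -> set (cantor_pow m)) :
  (forall z, (forall p, exists2 y, K y & agree p z y) -> K z) ->
  (forall n, bit_open (G n)) -> (exists z, K z) ->
  (forall z p n0, K z -> exists n y, [/\ (n0 <= n)%N, K y, agree p z y & G n y]) ->
  exists2 z, K z & lim_sup_set G z.
Proof.
move=> cK oG [z0 Kz0] dense.
have /choice[next nextP] (s : nat * (cantor_pow m * nat)) :
    exists t : cantor_pow m * nat, K s.2.1 ->
      [/\ K t.1, agree s.2.2 s.2.1 t.1, (s.2.2 < t.2)%N &
          exists2 n, (s.1 <= n)%N & forall y, agree t.2 t.1 y -> G n y].
  case: s => i [z p] /=; have [Kz|] := pselect (K z); last by exists (z, p).
  have [n [y [ni Ky zy /oG[q Gq]]]] := dense z p i Kz.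
  (* The new precision decides membership in [G n] and exceeds the old one. *)
  exists (y, maxn p.+1 q) => _; split=> //=; first exact: leq_maxl.
  exists n => // y' h; apply: Gq; apply: agree_le h; exact: leq_maxr.
pose st := fix st i := if i is i'.+1 then next (i', st i') else (z0, 0%N).
pose Z i := (st i).1; pose q i := (st i).2.
have KZ i : K (Z i).
  by elim: i => // i IH; have [] := nextP (i, st i) IH.
have qS i : (q i < q i.+1)%N by have [] := nextP (i, st i) (KZ i).
have ZS i : agree (q i) (Z i) (Z i.+1) by have [] := nextP (i, st i) (KZ i).
have qi i : (i <= q i)%N by elim: i => // i IH; exact: leq_ltn_trans (qS i).
have qle i j : (i <= j)%N -> (q i <= q j)%N.
  move=> /subnK <-; elim: (j - i)%N => // n IH; apply: (leq_trans IH).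
  by rewrite addSn ltnW.
have Zle i j : (i <= j)%N -> agree (q i) (Z i) (Z j).
  move=> /subnK <-; elim: (j - i)%N => // n IH; apply: (agree_trans IH).
  by rewrite addSn; apply: agree_le (ZS _); apply: qle; exact: leq_addl.
(* The bit [j] is final at stage [j.+1], as [q j.+1 > j]. *)
pose z : cantor_pow m :=
  [tuple (fun j => tnth (Z j.+1) i j) : cantor_space | i < m].
have Zz i : agree (q i) (Z i) z.
  move=> c j ji; rewrite tnth_mktuple.
  have [ij|ij] := leqP i j.+1; first exact: Zle ij c j ji.
  by apply/esym/(Zle _ _ (ltnW ij)); exact: qi.
exists z.
  apply: cK => p; exists (Z p) => //; apply: agree_sym; apply: agree_le (Zz p).
  exact: qi.
move=> i _; have [_ _ _ [n ni Gn]] := nextP (i, st i) (KZ i).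
by exists n => //; apply: Gn; exact: (Zz i.+1).
Qed.

End density_kernel.

(** * Null-additive sets have few prefixes *)
Section slalom.
Context (R : realType) (m : nat) (i0 : 'I_m).
Let P := coin_pow R m.

(** The pieces are indexed by a cylinder that meets [K] and a threshold [n0]: the
    piece consists of the [x] such that the translates of the sparse sets by [x]
    avoid the trace of the cylinder on [K] from [n0] on.  The measure of this trace
    does not depend on [x], which bounds the number of prefixes uniformly. *)
Lemma null_additive_slalom (X : set (cantor_pow m)) (d H : nat -> nat) :
  null_additive R X ->
  (forall n, (1 - 2^-1 ^+ n) ^+ H n <= 2^-1 ^+ n :> R) ->
  exists Xs : nat -> set (cantor_pow m), X `<=` \bigcup_j Xs j /\
    forall j, exists n0, forall n, (n0 <= n)%N ->
      exists2 S : {set {ffun 'I_m * 'I_(d n) -> bool}}, (#|S| <= H n)%N &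
        forall x, Xs j x -> bit_prefix (d n) x \in S.
Proof.
move=> aX hH; pose G n := sparse i0 (d n) n.
have oG n : bit_open (G n) := decided_open (@decided_sparse m i0 (d n) n).
have mG n : measurable (G n) by exact: measurable_sparse.
have nM : null R (lim_sup_set G).
  apply: (@borel_cantelli _ _ _ _ _ 0) => // n _.
  by rewrite (pr_sparse R).
have h2 : 0 < 2^-1 :> R by rewrite invr_gt0.
have [U [oU XU U2]] := null_open_cover (aX _ nM) h2.
have mU := measurable_bit_open oU.
pose K := kernel_off R U.
have K0 : exists z, K z.
  by apply: kernel_off_nonempty => //; apply: (le_lt_trans U2); rewrite invf_lt1 ?ltr1n.
pose T := ({p : nat & {ffun 'I_m * 'I_p -> bool}} * nat)%type.
pose miss (t : T) := [set x | exists z, [/\ K z,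
  bit_prefix (tag t.1) z = tagged t.1 & forall n y, (t.2 <= n)%N -> K y ->
     agree (tag t.1) z y -> ~ translate x (G n) y]].
exists (fun j => if unpickle j is Some t then miss t else set0); split.
  move=> x Xx; suff [t xt] : exists t, miss t x by exists (pickle t); rewrite ?pickleK.
  apply: contrapT => nmiss.
  have [z Kz Mz] : exists2 z, K z & lim_sup_set (fun n => translate x (G n)) z.
    apply: baire_lim_sup => // [z|n|z p n0 Kz].
    - exact: kernel_off_closed.
    - exact: bit_open_translate.
    apply: contrapT => nex; apply: nmiss.
    exists (existT (fun p => {ffun 'I_m * 'I_p -> bool}) p (bit_prefix p z), n0).
    exists z; split=> // n y n0n Ky zy Gy.
    by apply: nex; exists n, y.
  apply: (kernel_off_disjoint oU Kz); apply: XU.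
  exists x => //; exists (cantor_pow_xor x z); last exact: cantor_pow_xorK.
  by move=> n /Mz[j nj Gj]; exists j.
move=> j; case: unpickle => [[[p w] n0]|]; last first.
  by exists 0%N => n _; exists finset.set0; rewrite ?cards0.
set A := miss _; have [[x0 [z [Kz /= zw _]]]|A0] := pselect (exists x, A x); last first.
  by exists 0%N => n _; exists finset.set0; rewrite ?cards0// => x Ax; case: A0; exists x.
have := @kernel_off_cylinder_gt0 R _ U p z mU Kz.
set B := _ `&` _; move=> B0.
have mB : measurable B.
  by apply: measurableI; [exact: measurable_kernel_off|exact: measurable_cylinder].
have [n1 n1P] : exists n1, forall n, (n1 <= n)%N -> 2^-1 ^+ n < pr P B.
  have /cvgrPdist_lt/(_ _ B0)[n1 _ n1P] : (2^-1 ^+ n : R) @[n --> \oo] --> (0 : R).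
    by apply: cvg_expr; rewrite ger0_norm ?invf_lt1 ?ltr1n// ltW.
  exists n1 => n /n1P; rewrite sub0r normrN ger0_norm; [by []|].
  by rewrite exprn_ge0// ltW.
exists (maxn n0 n1) => n; rewrite geq_max => /andP[n0n n1n].
pose S := [set v : {ffun 'I_m * 'I_(d n) -> bool} |
  `[< exists2 x, A x & bit_prefix (d n) x = v >]]%SET.
exists S; last by move=> x Ax; rewrite inE; apply/asboolP; exists x.
have /choice[rep repP] (v : {ffun 'I_m * 'I_(d n) -> bool}) : exists x,
    v \in S -> A x /\ bit_prefix (d n) x = v.
  have [|vS] := boolP (v \in S); last by exists x0.
  by rewrite inE => /asboolP[x Ax xv]; exists x.
rewrite leqNgt; apply/negP => HS.
have := n1P _ n1n; rewrite ltNge => /negP; apply.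
have h0 : 0 <= 2^-1 ^+ n :> R by rewrite exprn_ge0// ltW.
have h1 : 2^-1 ^+ n <= 1 :> R by rewrite exprn_ile1 ?invf_le1 ?ler1n// ltW.
have e0 : 0 <= 1 - 2^-1 ^+ n :> R by rewrite subr_ge0.
have e1 : 1 - 2^-1 ^+ n <= 1 :> R by rewrite gerBl.
apply: (@le_trans _ _ ((1 - 2^-1 ^+ n : R) ^+ #|S|)); last first.
  apply: le_trans (hH n).
  by apply: ler_wiXn2l => //; exact: ltnW.
rewrite cardE -(@pr_avoid_sparse R m i0 (d n) n (enum S) rep) ?enum_uniq//; last first.
  by move=> v; rewrite mem_enum => /repP[].
apply: pr_le => //.
  rewrite (_ : [set _ | _] = \bigcap_(v in [set` enum S]) ~` translate (rep v) (G n)).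
    apply: fin_bigcap_measurable => [|v _]; first exact: finite_seq.
    by apply: measurableC; apply: measurable_translate.
  by apply/seteqP; split=> y h v /h.
move=> y [Ky zy] v; rewrite mem_enum => /repP[[z' [Kz' /= z'w h]] _].
apply: h => //; apply: agree_trans zy; apply/bit_prefixP.
by rewrite z'w zw.
Qed.

End slalom.

(** * Null-additivity survives the embedding of C^k into C^(k+l) *)
Section null_additive_times_zero.
Context (R : realType).

Definition cantor_pow0 l : cantor_pow l := [tuple (fun=> false) : cantor_space | _ < l].

Lemma cantor_pow_xor0 l (b : cantor_pow l) : cantor_pow_xor (cantor_pow0 l) b = b.
Proof.
by apply/eq_from_tnth => i; rewrite !tnth_mktuple; apply/funext.
Qed.

Lemma cantor_pow_xor_cat k l (a c : cantor_pow k) (b d : cantor_pow l) :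
  cantor_pow_xor (cantor_cat a b) (cantor_cat c d) =
  cantor_cat (cantor_pow_xor a c) (cantor_pow_xor b d).
Proof.
apply/eq_from_tnth => i; rewrite tnth_mktuple.
by case: (split_ordP i) => j ->; rewrite ?tnth_lshift ?tnth_rshift tnth_mktuple.
Qed.

Lemma agree_cat k l p (a c : cantor_pow k) (b : cantor_pow l) :
  agree p a c -> agree p (cantor_cat a b) (cantor_cat c b).
Proof.
move=> ac i n np.
by case: (split_ordP i) => j ->; rewrite ?tnth_lshift ?tnth_rshift ?ac.
Qed.

Lemma geometric_exponent (n : nat) :
  exists h, (1 - 2^-1 ^+ n) ^+ h <= 2^-1 ^+ n :> R.
Proof.
have p0 : 0 < 2^-1 ^+ n :> R by rewrite exprn_gt0// invr_gt0.
have p1 : 2^-1 ^+ n <= 1 :> R by rewrite exprn_ile1 ?invf_le1 ?ler1n// invr_ge0.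
have q0 : 0 <= 1 - 2^-1 ^+ n :> R by rewrite subr_ge0.
have /cvgrPdist_le/(_ _ p0)[h _ hP] :
    ((1 - 2^-1 ^+ n) ^+ h : R) @[h --> \oo] --> (0 : R).
  by apply: cvg_expr; rewrite ger0_norm// gtrBl.
exists h; have := hP h (leqnn h).
by rewrite sub0r normrN ger0_norm// exprn_ge0.
Qed.

(** A clopen set [F n] decided by [p n] bits is translated in the same way by all
    points with the same prefix of length [p n], so a bound on the number of
    prefixes bounds the measure of the union of its translates. *)
Lemma null_additive_cat0 k l (X : set (cantor_pow k)) (N : set (cantor_pow (k + l))) :
  (0 < k)%N -> null_additive R X -> null R N ->
  null R (\bigcup_(x in X) translate (cantor_cat x (cantor_pow0 l)) N).
Proof.
(* Some coordinate must carry the blocks of bits that the sparse sets read. *)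
move=> k0 aX nN; pose i0 := Ordinal k0.
have /choice[H hH] := geometric_exponent.
(* The successor guards against [H n = 0]. *)
pose e n : R := 2^-1 ^+ n / (H n).+1%:R.
have h2 : 0 < 2^-1 :> R by rewrite invr_gt0.
have e0 n : 0 < e n by rewrite divr_gt0// exprn_gt0.
have [F [p [dF Fe NF]]] := null_decided_lim_sup nN e0.
have mF n : measurable (F n) := measurable_decided (dF n).
have [Xs [XXs hXs]] := null_additive_slalom i0 p aX hH.
pose Z j := \bigcup_(x in Xs j) translate (cantor_cat x (cantor_pow0 l)) N.
apply: (@negligibleS _ _ _ _ (\bigcup_j Z j)).
  by move=> z [x /XXs[j _ Xx] Nz]; exists j => //; exists x.
apply: negligible_bigcup => j; have {hXs}[n0 hS] := hXs j.
have exS n : exists S : {set {ffun 'I_k * 'I_(p n) -> bool}},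
    (n0 <= n)%N -> (#|S| <= H n)%N /\ forall x, Xs j x -> bit_prefix (p n) x \in S.
  have [/hS[S SH XS]|] := leqP n0 n; first by exists S.
  by exists finset.set0.
pose S n := sval (cid (exS n)); have SP n := svalP (cid (exS n)).
have /choice[rep repP] (t : {n : nat & {ffun 'I_k * 'I_(p n) -> bool}}) :
    exists x, forall y, bit_prefix (p (tag t)) y = tagged t -> agree (p (tag t)) x y.
  have [[y yt]|no] := pselect (exists y, bit_prefix (p (tag t)) y = tagged t).
    by exists y => y' y't; apply/bit_prefixP; rewrite yt y't.
  by exists (cantor_pow0 k) => y yt; case: no; exists y.
pose r n w := rep (existT (fun n => {ffun 'I_k * 'I_(p n) -> bool}) n w).
pose A n := \bigcup_(w in [set` enum (S n)])
  translate (cantor_cat (r n w) (cantor_pow0 l)) (F n).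
have mA n : measurable (A n).
  apply: fin_bigcup_measurable => [|w _]; first exact: finite_seq.
  exact: measurable_translate.
apply: (@negligibleS _ _ _ _ (lim_sup_set A)).
  move=> z [x Xx /NF Fz] i _; have [n /= ni Fnz] := Fz (maxn i n0) I.
  exists n; first exact: leq_trans (leq_maxl _ _) ni.
  have [_ /(_ x Xx) xS] := SP n (leq_trans (leq_maxr _ _) ni).
  exists (bit_prefix (p n) x); first by rewrite /= mem_enum.
  have xr : agree (p n) x (r n (bit_prefix (p n) x)).
    by apply: agree_sym; exact: (repP (existT _ n _)).
  have xr0 := agree_cat (cantor_pow0 l) xr.
  by apply: (dF n) Fnz => c b bp; rewrite !tnth_xor xr0.
apply: (@borel_cantelli _ _ _ _ _ n0) => // n n0n.
have [SH _] := SP n n0n.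
apply: (@le_trans _ _ ((size (enum (S n)))%:R * e n)).
  apply: pr_bigcup_seq => [w|w _]; first exact: measurable_translate.
  by rewrite pr_translate.
rewrite /e mulrCA ger_pMr ?exprn_gt0// ler_pdivrMr// mul1r ler_nat -cardE.
exact: leqW.
Qed.

End null_additive_times_zero.

Theorem theorem1p17 (R : realType) (k l : nat)
    (hk : (1 <= k)%N) (hl : (1 <= l)%N)
    (X : set (cantor_pow k)) (Y : set (cantor_pow l)) :
  null_additive R X -> strongly_meager R Y ->
  strongly_meager R (cantor_prod X Y).
Proof.
move=> aX mY N nN XYN.
have [a na] := null_cat_section (null_additive_cat0 hk aX nN).
apply: (mY _ na); apply/seteqP; split=> // b _.
have : set_xor (cantor_prod X Y) N (cantor_cat a b) by rewrite XYN.
move=> [_ [x Xx [y Yy <-]] [n Nn e]].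
exists y => //; exists (cantor_pow_xor y b); last exact: cantor_pow_xorK.
exists x => //; rewrite /translate /= cantor_pow_xor_cat cantor_pow_xor0.
rewrite -cantor_pow_xor_cat -e (_ : [tuple of x ++ y] = cantor_cat x y)//.
by rewrite cantor_pow_xorK.
Qed.
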